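(* Let $m,n\ge 1$ be integers and let $a_1,\dots,a_m,b_1,\dots,b_n$ be positive real numbers. Consider the toy scattering model with $m$ type A particles of speeds $a_1,\dots,a_m$ and $n$ type B particles of speeds $b_1,\dots,b_n$, started from any initial positions in which every type A particle is to the left of every type B particle. Then $$P(\text{A wins})=\int\cdots\int_{R} dx_1\cdots dx_m\,dy_1\cdots dy_n ,$$ i.e. $P(\text{A wins})$ is the $(m+n)$-dimensional Lebesgue measure of $$R=\big\{(x_1,\dots,x_m,y_1,\dots,y_n)\in[0,1]^{m+n} : x_1^{a_1}x_2^{a_2}\cdots x_m^{a_m}<y_1^{b_1}y_2^{b_2}\cdots y_n^{b_n}\big\}.$$
   Context: Toy scattering model. There are $m$ type A particles $A_1,\dots,A_m$ with speeds $a_1,\dots,a_m>0$ and $n$ type B particles $B_1,\dots,B_n$ with speeds $b_1,\dots,b_n>0$ on the real line. Type A particles move in the positive direction and type B particles in the negative direction, at constant speed. Initially $A_i$ is at position $u_i\in\mathbb{R}$ and $B_j$ at position $v_j\in\mathbb{R}$, with $u_i<v_j$ for all $i,j$. Particles of the same type pass freely through each other. If $A_i$ and $B_j$ are both still alive at their meeting time $t_{ij}=(v_j-u_i)/(a_i+b_j)$, they collide: with probability $a_i/(a_i+b_j)$ particle $A_i$ survives and $B_j$ is annihilated, and with probability $b_j/(a_i+b_j)$ particle $B_j$ survives and $A_i$ is annihilated; the survivor continues with unchanged velocity. Outcomes of different collisions are independent. Pairs $(i,j)$ are processed in nondecreasing order of $t_{ij}$, ties being broken by an arbitrary fixed order.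 The process continues until only one type of particle survives. ''A wins'' is the event that all type B particles are annihilated; ''B wins'' is the event that all type A particles are annihilated. *)

(* Defs.v *)
From HB Require Import structures.
From mathcomp Require Import all_boot all_order all_algebra.
From mathcomp Require Import all_classical all_reals all_analysis.

Set Implicit Arguments.
Unset Strict Implicit.
Unset Printing Implicit Defensive.

Import Order.TTheory GRing.Theory Num.Theory.
Import numFieldNormedType.Exports.

Local Open Scope classical_set_scope.
Local Open Scope ring_scope.

Section Lebesgue.
Variable R : realType.
Local Notation RM := (measurableTypeR R).

Definition tcons n (z : RM * n.-tuple RM) : n.+1.-tuple RM :=
  [tuple of z.1 :: z.2].

Lemma measurable_tcons n : measurable_fun [set: RM * n.-tuple RM] (@tcons n).
Proof. exact: (measurable_cons (f := fst) (g := snd)). Qed.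

Section step.
Variables (n : nat) (mu : {sigma_finite_measure set (n.-tuple RM) -> \bar R}).

Definition lebesgue_cons : set (n.+1.-tuple RM) -> \bar R :=
  pushforward (product_measure1 lebesgue_measure mu) (@tcons n).

Let mtcons : measurable_fun setT (@tcons n) := @measurable_tcons n.

Let lebesgue_cons0 : lebesgue_cons set0 = 0%E.
Proof. exact: measure0. Qed.

Let lebesgue_cons_ge0 A : (0 <= lebesgue_cons A)%E.
Proof. exact: measure_ge0. Qed.

Let lebesgue_cons_sigma_additive : semi_sigma_additive lebesgue_cons.
Proof. exact: measure_semi_sigma_additive. Qed.

HB.instance Definition _ := isMeasure.Build _ _ _ lebesgue_cons
  lebesgue_cons0 lebesgue_cons_ge0 lebesgue_cons_sigma_additive.

Lemma lebesgue_cons_sigma_finite : sigma_finite setT lebesgue_cons.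
Proof.
have /sigma_finiteP[F [TF ndF Foo]] := sigma_finiteT (@lebesgue_measure R).
have /sigma_finiteP[G [TG ndG Goo]] := sigma_finiteT mu.
pose uncons (t : n.+1.-tuple RM) : RM * n.-tuple RM :=
  (thead t, [tuple of behead t]).
have tconsK : cancel (@tcons n) uncons.
  by case=> x t; rewrite /uncons /tcons /=; congr pair; exact/val_inj.
have munc : measurable_fun setT uncons.
  apply: measurable_fun_pair; first exact: measurable_tnth.
  exact: measurable_behead.
exists (fun k => uncons @^-1` (F k `*` G k)).
  apply/esym/seteqP; split => // t _.
  have : [set: RM] (thead t) by [].
  have : [set: n.-tuple RM] [tuple of behead t] by [].
  rewrite TF TG => -[k _ Gk] [l _ Fl]; exists (maxn k l) => //; split => /=.
  - by move: (thead t) Fl; exact/subsetPset/ndF/leq_maxr.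
  - by move: Gk; exact/subsetPset/ndG/leq_maxl.
move=> k; have [? ?] := Foo k; have [? ?] := Goo k; split.
  by rewrite -[X in measurable X]setTI; apply: munc => //; exact: measurableX.
rewrite /lebesgue_cons /pushforward -comp_preimage.
rewrite (_ : uncons \o _ = id); last by apply/funext => z /=; rewrite tconsK.
by rewrite preimage_id product_measure1E// lte_mul_pinfty// ge0_fin_numE.
Qed.

HB.instance Definition _ := Measure_isSigmaFinite.Build _ _ _ lebesgue_cons
  lebesgue_cons_sigma_finite.

End step.

(* Lebesgue measure on the Borel sets of R^n, as the n-fold product of the
   one-dimensional measure; lebesgue_tuple_box gives its value on boxes. *)
Fixpoint lebesgue_tuple n :
    {sigma_finite_measure set (n.-tuple RM) -> \bar R} :=
  match n with
  | 0 => dirac [tuple]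
  | k.+1 => lebesgue_cons (lebesgue_tuple k)
  end.

Lemma lebesgue_tuple_box n (A : 'I_n -> set RM) :
  (forall i, measurable (A i)) ->
  lebesgue_tuple n [set t | forall i, A i (tnth t i)] =
  (\prod_(i < n) lebesgue_measure (A i))%E.
Proof.
elim: n A => [|n IH] A mA.
  by rewrite big_ord0 /= diracE mem_set// => -[].
rewrite big_ord_recl -(IH (fun i => A (lift ord0 i)))//.
pose B := [set t : n.-tuple RM | forall i, A (lift ord0 i) (tnth t i)].
have mB : measurable B.
  rewrite (_ : B = \big[setI/setT]_(i <- index_enum 'I_n)
      ((@tnth n RM) ^~ i @^-1` A (lift ord0 i))).
    apply: bigsetI_measurable => i _.
    by rewrite -[X in measurable X]setTI; exact: measurable_tnth.
  rewrite -bigcap_seq; apply/seteqP; split=> t /=.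
    by move=> h i _; exact: h.
  by move=> h i; apply: h; exact: mem_index_enum.
rewrite -[RHS]product_measure1E//= /lebesgue_cons /pushforward.
congr product_measure1; apply/seteqP; split=> -[x t] /=.
  move=> h; split=> [|i]; first exact: (h ord0).
  by have := h (lift ord0 i); rewrite tnthS.
by move=> [hx ht] i; case: (unliftP ord0 i) => [j ->|->]; rewrite ?tnthS.
Qed.

End Lebesgue.

Section Independence.
Context d (T : measurableType d) (R : realType) (P : probability T R).

Definition mutually_independent (I : finType) (E : I -> set T) : Prop :=
  forall J : {set I},
    P (\bigcap_(i in [set` J]) E i) = (\prod_(i in J) P (E i))%E.

End Independence.

Section Scattering.
Variables m n : nat.

(* The pair (i, j) of indices stands for the possible collision of the i-th
   type A particle with the j-th type B particle; a state is the pair of the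
   sets of type A and of type B particles still alive. *)
Local Notation hit := ('I_m * 'I_n)%type.
Local Notation state := ({set 'I_m} * {set 'I_n})%type.

Section Dynamics.

(* [favA (i, j)] tells that A_i is the survivor if A_i and B_j collide; it is
   not used when one of the two is already dead at their meeting time. *)
Variable favA : hit -> bool.

Definition process_pair (S : state) (p : hit) : state :=
  if (p.1 \in S.1) && (p.2 \in S.2) then
    if favA p then (S.1, S.2 :\ p.2) else (S.1 :\ p.1, S.2)
  else S.

(* Once one of the types is extinct the state no longer changes, so that
   running through all the pairs amounts to stopping at that moment. *)
Definition final_state (s : seq hit) : state :=
  foldl process_pair (finset.setT, finset.setT) s.

Definition A_wins (s : seq hit) : bool := (final_state s).2 == finset.set0.

End Dynamics.

Variable R : realType.
Variables (a u : 'I_m -> R) (b v : 'I_n -> R).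

Definition meeting_time (p : hit) : R :=
  (v p.2 - u p.1) / (a p.1 + b p.2).

(* Pairs with the same meeting time may come in any order. *)
Definition processing_order (s : seq hit) : bool :=
  perm_eq s (enum {: hit}) &&
  sorted (fun p q => meeting_time p <= meeting_time q) s.

(* The first m coordinates are the x_i, the last n ones are the y_j. *)
Definition win_region : set ((m + n).-tuple (measurableTypeR R)) :=
  [set t : (m + n).-tuple R |
    (forall k, 0 <= tnth t k <= 1) /\
    \prod_(i < m) (tnth t (lshift n i) `^ a i) <
    \prod_(j < n) (tnth t (rshift m j) `^ b j)].

End Scattering.

(* Main.v *)
(* For a state with alive sets S1, S2, let g (S1, S2) be the probability that
   prod_(i in S1) x_i^(a_i) < prod_(j in S2) y_j^(b_j) for independent uniform
   x_i, y_j. For every alive pair (i, j), averaging over x_i and y_j alone gives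
     g (S1, S2) = a_i/(a_i+b_j) g (S1, S2 \ j) + b_j/(a_i+b_j) g (S1 \ i, S2)
   (with X = - a ln x this is the memoryless property of the exponential law),
   which is the recursion obtained by conditioning on the outcome of the
   collision of A_i and B_j. Since it holds for every pair, the order of the
   collisions, hence the initial positions, play no role. *)

Require Import Defs.
From mathcomp Require Import all_boot all_order all_algebra.
From mathcomp Require Import all_classical all_reals all_analysis.
From mathcomp Require Import measurable_realfun.
From mathcomp Require Import ring lra.

Set Implicit Arguments.
Unset Strict Implicit.
Unset Printing Implicit Defensive.

Import Order.TTheory GRing.Theory Num.Theory.
Import numFieldNormedType.Exports.

Local Open Scope classical_set_scope.
Local Open Scope ring_scope.

(** * Iterated uniform integrals over tuples *)

Section CubeIntegral.
Context (R : realType).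
Local Notation RM := (measurableTypeR R).
Local Notation U := (uniform_prob (@ltr01 R)).
Local Open Scope ereal_scope.

(** Expectation over independent uniform coordinates. Peeling off the head matches the recursion of
    [lebesgue_tuple] and leaves one-dimensional integrals to which Tonelli applies. *)
Fixpoint cube_int n : (n.-tuple RM -> \bar R) -> \bar R :=
  match n with
  | 0 => fun f => f [tuple]
  | k.+1 => fun f => \int[U]_x cube_int (fun t => f (tcons (x, t)))
  end.

Lemma cube_int_ge0 n (f : n.-tuple RM -> \bar R) :
  (forall t, 0 <= f t) -> 0 <= cube_int f.
Proof.
elim: n f => [f f0|n IH f f0] /=; first exact: f0.
by apply: integral_ge0 => x _; exact: IH.
Qed.

(** The parameter space [X] is arbitrary because the induction moves the head coordinate into it:
    the claim for [X * RM], with Tonelli's measurability, gives the claim for [X]. *)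
Lemma measurable_cube_int n d (X : measurableType d) (f : X * n.-tuple RM -> \bar R) :
  (forall z, 0 <= f z) -> measurable_fun [set: X * n.-tuple RM] f ->
  measurable_fun setT (fun x => cube_int (fun t => f (x, t))).
Proof.
elim: n d X f => [|n IH] d X f f0 mf /=.
  by apply: (measurableT_comp mf); exact: measurable_fun_pair.
pose g (z : X * RM) := cube_int (fun t => f (z.1, tcons (z.2, t))).
apply: (@measurable_fun_fubini_tonelli_F _ _ X RM R U g).
  apply: (IH _ (X * RM)%type (fun z => f (z.1.1, tcons (z.1.2, z.2)))) => //.
  apply: (measurableT_comp mf); apply: measurable_fun_pair.
    exact: measurableT_comp.
  apply: (measurableT_comp (@measurable_tcons R n)).
  by apply: measurable_fun_pair => //; exact: measurableT_comp.
by move=> z; exact: cube_int_ge0.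
Qed.

Lemma measurable_cube_int_tcons n (f : n.+1.-tuple RM -> \bar R) :
  (forall t, 0 <= f t) -> measurable_fun setT f ->
  measurable_fun setT (fun x => cube_int (fun t => f (tcons (x, t)))).
Proof.
move=> f0 mf.
apply: (@measurable_cube_int _ _ RM (fun z => f (tcons z))) => //.
exact: (measurableT_comp mf (@measurable_tcons R n)).
Qed.

Lemma measurable_tcons_r n (x : RM) d (Y : measurableType d) (f : n.+1.-tuple RM -> Y) :
  measurable_fun setT f ->
  measurable_fun setT (fun t : n.-tuple RM => f (tcons (x, t))).
Proof.
move=> mf; apply: (measurableT_comp mf).
apply: (measurableT_comp (@measurable_tcons R n)).
exact: measurable_fun_pair.
Qed.

Lemma cube_intD n (f g : n.-tuple RM -> \bar R) :
  (forall t, 0 <= f t) -> measurable_fun setT f ->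
  (forall t, 0 <= g t) -> measurable_fun setT g ->
  cube_int (fun t => f t + g t) = cube_int f + cube_int g.
Proof.
elim: n f g => [//|n IH] f g f0 mf g0 mg /=.
rewrite -ge0_integralD//.
- by apply: eq_integral => x _; rewrite IH//; exact: measurable_tcons_r.
- by move=> x _; exact: cube_int_ge0.
- exact: measurable_cube_int_tcons.
- by move=> x _; exact: cube_int_ge0.
- exact: measurable_cube_int_tcons.
Qed.

Lemma cube_intZl n (k : R) (f : n.-tuple RM -> \bar R) :
  (0 <= k)%R -> (forall t, 0 <= f t) -> measurable_fun setT f ->
  cube_int (fun t => k%:E * f t) = k%:E * cube_int f.
Proof.
move=> k0; elim: n f => [//|n IH] f f0 mf /=.
rewrite -ge0_integralZl//.
- by apply: eq_integral => x _; rewrite IH//; exact: measurable_tcons_r.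
- exact: measurable_cube_int_tcons.
- by move=> x _; exact: cube_int_ge0.
Qed.

Lemma cube_int_cst n (k : R) : cube_int (fun _ : n.-tuple RM => k%:E) = k%:E.
Proof.
elim: n => [//|n IH] /=; rewrite IH integral_cst//.
by rewrite [X in _ * X](_ : _ = 1) ?mule1//; exact: probability_setT.
Qed.

(** Tonelli, one coordinate at a time: the integral in [x] is exchanged with that of the head
    coordinate, then with the others by induction. *)
Lemma cube_int_swap n (f : RM * n.-tuple RM -> \bar R) :
  (forall z, 0 <= f z) -> measurable_fun [set: RM * n.-tuple RM] f ->
  \int[U]_x cube_int (fun t => f (x, t)) = cube_int (fun t => \int[U]_x f (x, t)).
Proof.
elim: n f => [//|n IH] f f0 mf /=.
pose g (z : RM * RM) := cube_int (fun t => f (z.1, tcons (z.2, t))).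
rewrite (@fubini_tonelli _ _ RM RM R U U g); last 2 first.
- apply: (@measurable_cube_int _ _ (RM * RM)%type (fun z => f (z.1.1, tcons (z.1.2, z.2)))) => //.
  apply: (measurableT_comp mf); apply: measurable_fun_pair.
    exact: measurableT_comp.
  apply: (measurableT_comp (@measurable_tcons R n)).
  by apply: measurable_fun_pair => //; exact: measurableT_comp.
- by move=> z; exact: cube_int_ge0.
apply: eq_integral => y _; rewrite /g /=.
apply: (IH (fun z => f (z.1, tcons (y, z.2)))) => //.
apply: (measurableT_comp mf); apply: measurable_fun_pair => //.
apply: (measurableT_comp (@measurable_tcons R n)).
exact: measurable_fun_pair.
Qed.

Lemma eq_integral_uniform (f g : RM -> \bar R) :
  (forall x, 0 <= f x) -> measurable_fun setT f ->
  (forall x, 0 <= g x) -> measurable_fun setT g ->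
  (forall x, (0 <= x <= 1)%R -> f x = g x) ->
  \int[U]_x f x = \int[U]_x g x.
Proof.
move=> f0 mf g0 mg fg; rewrite !integral_uniform//; congr *%E.
by apply: eq_integral => x; rewrite inE/= in_itv/= => /fg.
Qed.

Definition in_cube n (t : n.-tuple RM) := forall k, (0 <= tnth t k <= 1)%R.

Lemma in_cube_tcons n x (t : n.-tuple RM) :
  in_cube (tcons (x, t)) <-> (0 <= x <= 1)%R /\ in_cube t.
Proof.
split=> [h|[x01 ht] k].
  split=> [|k]; first exact: (h ord0).
  by have := h (lift ord0 k); rewrite tnthS.
by case: (unliftP ord0 k) => [j ->|->] //; rewrite tnthS; exact: ht.
Qed.

(** Makes available pointwise arguments that need coordinates in [[0, 1]], such as bounding products
    of powers by [1]. *)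
Lemma eq_cube_int n (f g : n.-tuple RM -> \bar R) :
  (forall t, 0 <= f t) -> measurable_fun setT f ->
  (forall t, 0 <= g t) -> measurable_fun setT g ->
  (forall t, in_cube t -> f t = g t) -> cube_int f = cube_int g.
Proof.
elim: n f g => [|n IH] f g f0 mf g0 mg fg /=; first by apply: fg => -[].
apply: eq_integral_uniform.
- by move=> x; exact: cube_int_ge0.
- exact: measurable_cube_int_tcons.
- by move=> x; exact: cube_int_ge0.
- exact: measurable_cube_int_tcons.
- move=> x x01; apply: IH => //; try exact: measurable_tcons_r.
  by move=> t ht; apply: fg; apply/in_cube_tcons.
Qed.

(** * Resampling a single coordinate *)

Definition upd n (k : 'I_n) (x : RM) (t : n.-tuple RM) : n.-tuple RM :=
  [tuple if i == k then x else tnth t i | i < n].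

Lemma tnth_upd n (k : 'I_n) x (t : n.-tuple RM) i :
  tnth (upd k x t) i = if i == k then x else tnth t i.
Proof. by rewrite tnth_mktuple. Qed.

Lemma measurable_upd n (k : 'I_n) :
  measurable_fun [set: RM * n.-tuple RM] (fun z => upd k z.1 z.2).
Proof.
apply/measurable_fun_tnthP => i.
rewrite (_ : _ \o _ = fun z => if i == k then z.1 else tnth z.2 i); last first.
  by apply/funext => z /=; rewrite tnth_upd.
case: (i == k).
  exact: measurable_fst.
exact: (measurableT_comp (@measurable_tnth _ RM n i) measurable_snd).
Qed.

Lemma upd_tcons0 n (x y : RM) (t : n.-tuple RM) :
  upd ord0 x (tcons (y, t)) = tcons (x, t).
Proof.
apply: eq_from_tnth => i; rewrite tnth_upd.
by case: (unliftP ord0 i) => [j ->|->]//=; rewrite !tnthS.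
Qed.

Lemma upd_tconsS n (k : 'I_n) (x y : RM) (t : n.-tuple RM) :
  upd (lift ord0 k) x (tcons (y, t)) = tcons (y, upd k x t).
Proof.
apply: eq_from_tnth => i; rewrite tnth_upd.
case: (unliftP ord0 i) => [j ->|->]//=; rewrite !tnthS tnth_upd.
by rewrite (inj_eq lift_inj).
Qed.

(** Redrawing coordinate [k] independently preserves the law of the tuple. If [k] is the head, the
    old head becomes a dummy variable of total mass [1] and Tonelli concludes; otherwise induction
    applies under the head integral. This is how the average over chosen coordinates is isolated. *)
Lemma cube_int_resample n (k : 'I_n) (f : n.-tuple RM -> \bar R) :
  (forall t, 0 <= f t) -> measurable_fun setT f ->
  cube_int (fun t => \int[U]_x f (upd k x t)) = cube_int f.
Proof.
elim: n k f => [[]//|n IH] k f f0 mf /=.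
case: (unliftP ord0 k) => [j ->|->].
  apply: eq_integral => y _.
  under eq_fun do under eq_integral do rewrite upd_tconsS.
  by apply: (IH j (fun t => f (tcons (y, t)))) => //; exact: measurable_tcons_r.
under eq_integral do under eq_fun do under eq_integral do rewrite upd_tcons0.
rewrite integral_cst// [X in _ * X](_ : _ = 1) ?mule1; last exact: probability_setT.
rewrite (@cube_int_swap _ (fun z => f (tcons z)))//.
exact: (measurableT_comp mf (@measurable_tcons R n)).
Qed.

(** * Comparison with Lebesgue measure on the cube *)

Lemma measurable_in_cube n : measurable (@in_cube n : set (n.-tuple RM)).
Proof.
rewrite (_ : @in_cube n = \big[setI/setT]_(i <- index_enum 'I_n)
    ((@tnth n RM) ^~ i @^-1` `[0%R, 1%R])).
  apply: bigsetI_measurable => i _.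
  by rewrite -[X in measurable X]setTI; exact: measurable_tnth.
rewrite -bigcap_seq; apply/seteqP; split=> t /=.
  by move=> h i _ /=; rewrite in_itv/=; exact: h.
by move=> h i; have := h i (mem_index_enum i); rewrite /= in_itv.
Qed.

(** The product measure integrates the measures of the sections at [x], to which the induction
    hypothesis applies, and the uniform law is Lebesgue measure restricted to [[0, 1]]. *)
Lemma lebesgue_tuple_cube n (A : set (n.-tuple RM)) :
  measurable A ->
  lebesgue_tuple R n (@in_cube n `&` A) = cube_int (fun t => (\1_A t)%:E).
Proof.
elim: n A => [|n IH] A mA /=.
  by rewrite diracE indicE in_setI mem_set// => -[].
rewrite /lebesgue_cons /pushforward /product_measure1 /=.
rewrite integral_uniform; last 2 first.
- apply: (@measurable_cube_int_tcons _ (fun t => (\1_A t)%:E)).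
    by move=> t; rewrite lee_fin.
  by apply/measurable_EFinP; exact: measurable_indic.
- by move=> x; apply: cube_int_ge0 => t; rewrite lee_fin.
rewrite subr0 invr1 mul1e [RHS]integral_mkcond.
apply: eq_integral => x _; rewrite patchE.
case: ifPn => [|/negP]; rewrite inE/= in_itv/= => x01.
  rewrite -IH; last first.
    rewrite -[X in measurable X]setTI.
    by apply: (@measurable_tcons_r _ x _ _ id) => //; exact: measurable_id.
  congr (lebesgue_tuple R n _); apply/seteqP; split=> t.
    by move/xsectionP => [/in_cube_tcons[_ ?] ?]; split.
  by move=> [? ?]; apply/xsectionP; split=> //; apply/in_cube_tcons.
(* For [x] outside [[0, 1]] the section misses the cube altogether. *)
rewrite (_ : xsection _ _ = set0) ?measure0//.
apply/seteqP; split=> // t /xsectionP[] /in_cube_tcons[] //.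
Qed.

End CubeIntegral.

(** * The two-dimensional collision identity *)

Section PowerIntegrals.
Context (R : realType).
Local Notation RM := (measurableTypeR R).
Local Notation U := (uniform_prob (@ltr01 R)).
Local Notation mu := (@lebesgue_measure R).

Lemma ltr_powR2r (a x y : R) : 0 < a -> 0 <= x -> 0 <= y ->
  (x `^ a < y `^ a) = (x < y).
Proof.
move=> a0 x0 y0; apply/idP/idP; last exact: gt0_ltr_powR.
by apply: contraTT; rewrite -!leNgt; apply: ge0_ler_powR => //; exact: ltW.
Qed.

Lemma powR_invK (a x : R) : 0 < a -> 0 <= x -> (x `^ a^-1) `^ a = x.
Proof. by move=> a0 x0; rewrite -powRrM mulVf ?gt_eqF// powRr1. Qed.

Lemma powR_ltl (x y a : R) : 0 < a -> 0 <= x -> 0 <= y ->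
  (x `^ a < y) = (x < y `^ a^-1).
Proof.
by move=> a0 x0 y0; rewrite -(ltr_powR2r a0 x0) ?powR_ge0// powR_invK.
Qed.

Lemma powR_ltr (x y a : R) : 0 < a -> 0 <= x -> 0 <= y ->
  (y < x `^ a) = (y `^ a^-1 < x).
Proof.
by move=> a0 x0 y0; rewrite -(ltr_powR2r a0 _ x0) ?powR_ge0// powR_invK.
Qed.

(** Serves the two-dimensional identity below: with [g = a / b], the integrand is the inner integral
    on the range where it is nonnegative. *)
Lemma integral_one_sub_powR (s g rho : R) : 0 < g -> 0 < rho ->
  (\int[mu]_(x in `[0%R, rho]) (1 - s * x `^ g)%:E =
  (rho - s * rho `^ (g + 1) / (g + 1))%:E)%E.
Proof.
move=> g0 rho0; have g1 : 0 < g + 1 by rewrite addr_gt0.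
have cvg_powR (x h : R) : 0 < x -> y `^ h @[y --> x] --> x `^ h.
  move=> x0; have : derivable (fun y : R => y `^ h) x 1.
    by apply: derivable_powR; rewrite in_itv/= x0.
  by move/derivable1_diffP/differentiable_continuous.
pose F x := x - s / (g + 1) * x `^ (g + 1).
rewrite (@continuous_FTC2 R (fun x => 1 - s * x `^ g) F)//.
- by rewrite /F powR0 ?gt_eqF// mulr0 subr0 sube0; congr EFin; rewrite mulrAC.
- apply/continuous_within_itvP => //; split.
  + move=> x; rewrite in_itv/= => /andP[x0 _].
    by apply: cvgB; [exact: cvg_cst|apply: cvgMr; exact: cvg_powR].
  (* At the endpoint [0] the power is controlled only by its right limit, which is [0] since [g] is
     positive. *)
  + by rewrite powR0 ?gt_eqF//; apply: cvgB; [exact: cvg_cst|apply: cvgMr; exact: powR_cvg0].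
  + apply: cvg_at_left_filter.
    by apply: cvgB; [exact: cvg_cst|apply: cvgMr; exact: cvg_powR].
- split.
  + move=> x; rewrite in_itv/= => /andP[x0 _].
    apply: derivableB => //; apply: derivableM => //.
    by apply: derivable_powR; rewrite in_itv/= x0.
  + rewrite /F powR0 ?gt_eqF//; apply: cvgB; first exact: cvg_at_right_filter.
    by apply: cvgMr; exact: powR_cvg0.
  + apply: cvg_at_left_filter; apply: cvgB => //.
    by apply: cvgMr; exact: cvg_powR.
- move=> x; rewrite in_itv/= => /andP[x0 _].
  have := is_derive1_powR (g + 1) x0 => dx.
  rewrite derive1E /F derive_val addrK /GRing.scale /=.
  by congr (_ - _); field; rewrite gt_eqF.
Qed.

(** * Uniform integrals of threshold indicators *)

Definition ind (b : bool) : \bar R := (b%:R)%:E.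

Lemma ind_ge0 b : (0 <= ind b)%E.
Proof. by rewrite lee_fin. Qed.

Lemma measurable_ind d (X : measurableType d) (f g : X -> R) :
  measurable_fun setT f -> measurable_fun setT g ->
  measurable_fun setT (fun x => ind (f x < g x)).
Proof.
move=> mf mg; apply/measurable_EFinP.
rewrite (_ : (fun _ => _) = fun x => if f x < g x then 1 else 0 : R); last first.
  by apply/funext => x; case: ltP.
by apply: measurable_fun_ifT => //; exact: measurable_fun_ltr.
Qed.

(** The condition on [f] is limited to [[0, 1]] because inequalities between powers are solved for
    [x] only when [x] is nonnegative. *)
Lemma integral_uniform_itv (f : RM -> bool) (i : interval R) :
  measurable_fun setT (fun x => ind (f x)) ->
  ([set` i] `<=` `[0, 1]) ->
  (forall x, 0 <= x <= 1 -> f x = (x \in i)) ->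
  (\int[U]_x ind (f x) = mu [set` i])%E.
Proof.
move=> mf i01 fi; rewrite integral_uniform//; last by move=> x; exact: ind_ge0.
rewrite subr0 invr1 mul1e.
rewrite (eq_integral (fun x : RM => (\1_([set` i] : set R) x)%:E)); last first.
  by move=> x; rewrite inE/= in_itv/= => x01; rewrite fi// /ind indicE mem_setE.
by rewrite integral_indic//= setIidl.
Qed.

Lemma integral_uniform_lt (f : RM -> bool) (r : R) :
  measurable_fun setT (fun x => ind (f x)) -> 0 <= r ->
  (forall x, 0 <= x <= 1 -> f x = (x < r)) ->
  (\int[U]_x ind (f x) = (Num.min 1 r)%:E)%E.
Proof.
move=> mf r0 fr; have [r1|r1] := ltP 1 r.
  rewrite (@integral_uniform_itv _ `[0, 1])//.
    by rewrite lebesgue_measure_itv/= lte_fin ltr01 oppr0 adde0.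
  move=> x /[dup] /andP[_ x1] x01.
  by rewrite fr// in_itv/= x01 (le_lt_trans x1).
rewrite (@integral_uniform_itv _ `[0, r[)//.
- rewrite lebesgue_measure_itv/= lte_fin; case: ltP => [_|r0'].
    by rewrite oppr0 adde0.
  by congr EFin; apply/eqP; rewrite eq_le r0.
- by move=> x /=; rewrite !in_itv/= => /andP[-> /ltW h]; rewrite (le_trans h).
- by move=> x /[dup] /andP[x0 _] x01; rewrite fr// in_itv/= x0.
Qed.

Lemma integral_uniform_gt (f : RM -> bool) (r : R) :
  measurable_fun setT (fun x => ind (f x)) -> 0 <= r ->
  (forall x, 0 <= x <= 1 -> f x = (r < x)) ->
  (\int[U]_x ind (f x) = (Num.max 0 (1 - r))%:E)%E.
Proof.
move=> mf r0 fr.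
rewrite (@integral_uniform_itv _ `]r, 1])//.
- rewrite lebesgue_measure_itv/= lte_fin -EFinB.
  by case: ltP => h; congr EFin; symmetry; [apply/max_idPr|apply/max_idPl]; lra.
- by move=> x /=; rewrite !in_itv/= => /andP[h ->]; rewrite ltW// (le_lt_trans r0).
- by move=> x /[dup] /andP[x0 x1] x01; rewrite fr// in_itv/= x1 andbT.
Qed.

Lemma measurable_ind_powRl (a c d : R) :
  measurable_fun setT (fun x : RM => ind (x `^ a * c < d)).
Proof.
apply: measurable_ind => //; apply: measurable_funM => //; exact: measurable_powR.
Qed.

Lemma measurable_ind_powRr (b c d : R) :
  measurable_fun setT (fun y : RM => ind (c < y `^ b * d)).
Proof.
apply: measurable_ind => //; apply: measurable_funM => //; exact: measurable_powR.
Qed.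

Lemma integral_ind_powRl (a c d : R) : 0 < a -> 0 < c -> 0 <= d ->
  (\int[U]_x ind ((x `^ a * c < d)%R) = (Num.min 1 ((d / c) `^ a^-1))%:E)%E.
Proof.
move=> a0 c0 d0; apply: integral_uniform_lt.
- exact: measurable_ind_powRl.
- exact: powR_ge0.
- move=> x /andP[x0 _]; rewrite -ltr_pdivlMr// powR_ltl//.
  by rewrite divr_ge0// ltW.
Qed.

Lemma integral_ind_powRr (b c d : R) : 0 < b -> 0 <= c -> 0 < d ->
  (\int[U]_y ind ((c < y `^ b * d)%R) =
   (Num.max 0 (1 - (c / d) `^ b^-1))%:E)%E.
Proof.
move=> b0 c0 d0; apply: integral_uniform_gt.
- exact: measurable_ind_powRr.
- exact: powR_ge0.
- move=> x /andP[x0 _]; rewrite -ltr_pdivrMr// powR_ltr//.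
  by rewrite divr_ge0// ltW.
Qed.

(** The inner integral in [y] is the positive part of [1 - s * x ^ (a / b)], which vanishes beyond
    [rho]. Integrating the power over [[0, rho]] gives the value; the right-hand side holds the
    closed forms of the two single integrals. *)
Lemma integral_ind_powR2_pos (a b c d : R) : 0 < a -> 0 < b -> 0 < c -> 0 < d ->
  (\int[U]_x \int[U]_y ind ((x `^ a * c < y `^ b * d)%R) =
   (a / (a + b) * Num.min 1 ((d / c) `^ a^-1) +
    b / (a + b) * Num.max 0 (1 - (c / d) `^ b^-1))%:E)%E.
Proof.
move=> a0 b0 c0 d0.
set s := (c / d) `^ b^-1; set rho := Num.min 1 ((d / c) `^ a^-1).
have s0 : 0 < s by rewrite powR_gt0// divr_gt0.
have dc0 : 0 < (d / c) `^ a^-1 by rewrite powR_gt0// divr_gt0.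
have rho0 : 0 < rho by rewrite lt_min ltr01.
have ab0 : 0 < a / b by rewrite divr_gt0.
(* The threshold [(d / c) ^ (1 / a)] is exactly the zero of [1 - s * x ^ (a / b)]; by monotonicity
   this fixes the sign on either side. *)
have sE : s * ((d / c) `^ a^-1) `^ (a / b) = 1.
  rewrite -powRrM mulrA mulVf ?gt_eqF// mul1r /s -powRM ?divr_ge0 ?ltW//.
  by rewrite (_ : c / d * (d / c) = 1) ?powR1//; field; rewrite !gt_eqF.
have key x : 0 <= x -> (s * x `^ (a / b) < 1) = (x < (d / c) `^ a^-1).
  by move=> x0; rewrite -sE ltr_pM2l// ltr_powR2r// ltW.
have key' x : 0 <= x -> (1 < s * x `^ (a / b)) = ((d / c) `^ a^-1 < x).
  by move=> x0; rewrite -sE ltr_pM2l// ltr_powR2r// ltW.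
under eq_integral.
  move=> x _; rewrite (@integral_ind_powRr b (x `^ a * c) d)//; last first.
    by rewrite mulr_ge0 ?powR_ge0// ltW.
  rewrite -mulrA powRM ?powR_ge0 ?divr_ge0 ?ltW// -powRrM -/s mulrC.
  over.
rewrite integral_uniform//=; last 2 first.
- apply/measurable_EFinP; apply: measurable_maxr => //.
  apply: (@measurable_funB _ RM R setT (cst 1) (fun x => s * x `^ (a / b))) => //.
  by apply: measurable_funM => //; exact: measurable_powR.
- by move=> x; rewrite lee_fin le_max lexx.
rewrite subr0 invr1 mul1e.
(* Cutting the domain at [rho] removes the maximum with [0]. *)
transitivity (\int[mu]_(x in `[0%R, rho]) (1 - s * x `^ (a / b))%:E)%E.
  rewrite [LHS]integral_mkcond [RHS]integral_mkcond.
  apply: eq_integral => x _; rewrite !patchE !mem_setE !in_itv/= le_min.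
  have [x0|//] := leP 0 x; rewrite /=.
  case: ifP => //= x1.
  have [xr|xr] := leP x ((d / c) `^ a^-1).
    by congr EFin; apply/max_idPr; rewrite subr_ge0 leNgt key'// -leNgt.
  by congr EFin; apply/max_idPl; rewrite subr_le0 leNgt key// -leNgt ltW.
rewrite integral_one_sub_powR//; congr EFin.
have rhoE : rho `^ (a / b + 1) = rho `^ (a / b) * rho.
  by rewrite powRD ?powRr1 ?ltW//; apply/implyP; rewrite gt_eqF// addr_gt0.
have ab : a / b + 1 = (a + b) / b by field; lra.
rewrite rhoE {}ab.
(* If the zero lies in [[0, 1]], then [rho] is that zero and [1 - s] is nonpositive, so only the
   first term survives. Otherwise [rho = 1] and both terms contribute. *)
have [h|h] := leP ((d / c) `^ a^-1) 1.
  have -> : rho = (d / c) `^ a^-1 by exact/min_idPr.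
  have s1 : 1 - s <= 0.
    by have := key 1 ler01; rewrite powR1 mulr1 subr_le0 leNgt => ->; rewrite -leNgt.
  rewrite (max_idPl s1) [s * _]mulrA sE; field; lra.
have -> : rho = 1 by apply/min_idPl/ltW.
have s1 : 0 <= 1 - s.
  have := key' 1 ler01; rewrite powR1 mulr1 subr_ge0 leNgt => ->.
  by rewrite -leNgt ltW.
rewrite (max_idPr s1) powR1; field; lra.
Qed.

(** Here [c] and [d] will be products over the other particles, which may vanish on the cube, so the
    degenerate values are included. *)
Lemma integral_ind_powR2 (a b c d : R) : 0 < a -> 0 < b -> 0 <= c -> 0 <= d ->
  (\int[U]_x \int[U]_y ind ((x `^ a * c < y `^ b * d)%R) =
   (a / (a + b))%:E * \int[U]_x ind ((x `^ a * c < d)%R) +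
   (b / (a + b))%:E * \int[U]_y ind ((c < y `^ b * d)%R))%E.
Proof.
move=> a0 b0 c0; rewrite le_eqVlt => /predU1P[<-|d0].
  (* With [d = 0] every right-hand factor is [0] and no strict inequality can hold: all three
     integrals vanish. *)
  have I0 (f : RM -> bool) : (forall x, f x = false) -> (\int[U]_x ind (f x) = 0)%E.
    by move=> f0; apply: integral0_eq => x _; rewrite f0.
  have lt0F x : (x `^ a * c < 0) = false.
    by apply/negbTE; rewrite -leNgt mulr_ge0// powR_ge0.
  rewrite (I0 (fun x => x `^ a * c < 0))// (I0 (fun y => c < y `^ b * 0)); last first.
    by move=> y; rewrite mulr0 ltNge c0.
  rewrite !mule0 adde0 integral0_eq// => x _.
  by rewrite (I0 (fun y => x `^ a * c < y `^ b * 0))// => y; rewrite mulr0.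
move: c0; rewrite le_eqVlt => /predU1P[<-|c0]; last first.
  rewrite integral_ind_powR2_pos// integral_ind_powRl ?ltW//.
  by rewrite integral_ind_powRr ?ltW// EFinD !EFinM.
have U1 k : (\int[U]_x k%:E = k%:E)%E.
  by rewrite integral_cst// [X in (_ * X)%E](_ : _ = 1%E) ?mule1//; exact: probability_setT.
(* With [c = 0 < d] all three integrals equal [1], and the two weights sum to [1]. *)
under eq_integral do under eq_integral do rewrite mulr0.
under [in RHS]eq_integral do rewrite mulr0 d0.
rewrite integral_ind_powRr// !U1 -!EFinM -EFinD; congr EFin.
by rewrite mul0r powR0 ?invr_eq0 ?gt_eqF// subr0 (max_idPr ler01) mulr1n; field; lra.
Qed.

End PowerIntegrals.

(** * The collision process *)

Section ScatteringProbability.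
Context (R : realType) (m n : nat) d (T : measurableType d) (P : probability T R).
Local Notation hit := ('I_m * 'I_n)%type.
Local Notation state := ({set 'I_m} * {set 'I_n})%type.
Variables (survA : hit -> set T) (q : hit -> R).
Hypothesis survA_meas : forall p, measurable (survA p).
Hypothesis survA_prob : forall p, P (survA p) = (q p)%:E.
Hypothesis survA_indep : mutually_independent P survA.

(** The event form of [A_wins], with an arbitrary starting state so that induction on the list of
    pairs can go through. *)
Definition wins_from (S : state) (s : seq hit) : set T :=
  [set w | (foldl (process_pair (fun p => w \in survA p)) S s).2 == finset.set0].

Definition alive (S : state) (p : hit) := (p.1 \in S.1) && (p.2 \in S.2).
Definition kill_A (S : state) (p : hit) : state := (S.1 :\ p.1, S.2).
Definition kill_B (S : state) (p : hit) : state := (S.1, S.2 :\ p.2).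

Lemma process_pairE fav S p : process_pair fav S p =
  if alive S p then if fav p then kill_B S p else kill_A S p else S.
Proof. by []. Qed.

Lemma wins_from_cons S p s :
  wins_from S (p :: s) =
  if alive S p then (survA p `&` wins_from (kill_B S p) s) `|`
                    (~` survA p `&` wins_from (kill_A S p) s)
  else wins_from S s.
Proof.
rewrite /wins_from /=; case: ifP => al; apply/seteqP; split=> w /=;
  rewrite process_pairE al //.
- by case: ifPn => [/set_mem|/negP/[!inE]] ? ?; [left|right].
- by case=> -[h]; [rewrite mem_set//|rewrite memNset].
Qed.

Lemma measurable_wins_from S s : measurable (wins_from S s).
Proof.
elim: s S => [S|p s IH S].
  rewrite /wins_from /=; have [h|h] := eqVneq S.2 finset.set0.
      by rewrite (_ : [set _ | _] = setT)//; apply/seteqP; split=> // w _; rewrite h eqxx.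
  by rewrite (_ : [set _ | _] = set0)//; apply/seteqP; split.
rewrite wins_from_cons; case: ifP => // _.
by apply: measurableU; apply: measurableI => //; exact: measurableC.
Qed.

(* Intersecting with the cylinder of the already decided collisions [J] is what
   lets the induction on [s] use mutual independence: the outcome "B survives"
   is the complement of survA p, handled by subtraction. *)
Lemma wins_from_prob (g : state -> R) :
  (forall S1, S1 != finset.set0 -> g (S1, finset.set0) = 1) ->
  (forall S2, g (finset.set0, S2) = 0) ->
  (forall S p, alive S p ->
     g S = q p * g (kill_B S p) + (1 - q p) * g (kill_A S p)) ->
  forall s S (J : {set hit}), uniq s ->
  (forall p, p \in J -> p \notin s) ->
  (forall p, alive S p -> p \in s) ->
  (S.1 != finset.set0) || (S.2 != finset.set0) ->
  P (\bigcap_(p in [set` J]) survA p `&` wins_from S s) =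
  (\prod_(p in J) q p * g S)%:E.
Proof.
move=> gA gB gr; elim=> [|p s IH] [S1 S2] J us Js Ss S0.
  have PJ : P (\bigcap_(p in [set` J]) survA p) = (\prod_(p in J) q p)%:E.
    rewrite survA_indep -prodEFin; apply: eq_bigr => p _; exact: survA_prob.
  rewrite /wins_from /=; have [h|h] := eqVneq S2 finset.set0.
    rewrite (_ : [set _ : T | true] = setT); last by apply/seteqP; split.
    by rewrite setIT PJ h gA ?mulr1//; move: S0; rewrite /= h eqxx orbF.
  rewrite (_ : [set _ : T | false] = set0); last by apply/seteqP; split.
  (* No pair is left to process, so no pair is alive: a nonempty [S2] forces [S1] to be empty, and A
     has lost. *)
  have [->|[i iS1]] := set_0Vmem S1; first by rewrite gB setI0 measure0 mulr0.
  case/set0Pn: h => j jS2.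
  by have := Ss (i, j); rewrite /alive /= iS1 jS2 => /(_ isT).
move: us => /= /andP[ps us].
have mJ : measurable (\bigcap_(p in [set` J]) survA p).
  by apply: fin_bigcap_measurable => //; exact: finite_finset.
rewrite wins_from_cons; case: ifPn => [al|al]; last first.
  apply: IH => //.
    by move=> r /Js; rewrite inE negb_or => /andP[].
  move=> r ar; have := Ss _ ar; rewrite inE => /predU1P[rp|//].
  by rewrite -rp ar in al.
have [al1 al2] := andP al.
have JsD r : r \in J -> r \notin s by move=> /Js; rewrite inE negb_or => /andP[].
have pJ : p \notin J.
  by apply/negP => /Js; rewrite inE eqxx.
have Ss' S' : (forall r, alive S' r -> alive (S1, S2) r && (r != p)) ->
    forall r, alive S' r -> r \in s.
  by move=> h r /h /andP[/Ss]; rewrite inE => /predU1P[->|//]; rewrite eqxx.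
have JE : \bigcap_(r in [set` p |: J]) survA r =
    survA p `&` \bigcap_(r in [set` J]) survA r.
  apply/seteqP; split=> w.
    by move=> h; split; [|move=> r rJ]; apply: h; rewrite /= !inE ?eqxx// [_ \in _]rJ orbT.
  by move=> [wp h] r /=; rewrite !inE => /predU1P[->//|]; exact: h.
have SB r : alive (kill_B (S1, S2) p) r -> alive (S1, S2) r && (r != p).
  rewrite /alive /= !inE => /and3P[-> h ->] /=.
  by apply: contraNneq h => ->.
have SA r : alive (kill_A (S1, S2) p) r -> alive (S1, S2) r && (r != p).
  rewrite /alive /= !inE => /andP[/andP[h -> ->]] /=.
  by apply: contraNneq h => ->.
have JpS r : r \in p |: J -> r \notin s.
  by rewrite !inE => /predU1P[->//|/JsD].
(* The survivor of the collision keeps its own type nonempty, so the state with both types extinct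
   is never reached. *)
have NB : ((kill_B (S1, S2) p).1 != finset.set0) || ((kill_B (S1, S2) p).2 != finset.set0).
  by apply/orP; left; apply/set0Pn; exists p.1.
have NA : ((kill_A (S1, S2) p).1 != finset.set0) || ((kill_A (S1, S2) p).2 != finset.set0).
  by apply/orP; right; apply/set0Pn; exists p.2.
(* [E1] treats the survival of A, with [p] added to the decided collisions. For the survival of B,
   [E3] ignores the outcome at [p] and [E2] gives the part inside [survA p] to be subtracted. *)
have E1 := IH _ _ us JpS (Ss' _ SB) NB.
have E2 := IH _ _ us JpS (Ss' _ SA) NA.
have E3 := IH _ _ us JsD (Ss' _ SA) NA.
rewrite JE big_setU1//= in E1 E2.
set C := \bigcap_(r in [set` J]) survA r in E1 E2 E3 *.
set WB := wins_from (kill_B _ _) _ in E1 *.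
set WA := wins_from (kill_A _ _) _ in E2 E3 *.
have mWA : measurable WA by exact: measurable_wins_from.
have mWB : measurable WB by exact: measurable_wins_from.
have mC : measurable C by exact: mJ.
rewrite (_ : C `&` _ = (survA p `&` C `&` WB) `|` (C `&` WA) `\` (survA p `&` C `&` WA)); last first.
  apply/seteqP; split=> w /=.
    by move=> [Cw [[? ?]|[? ?]]]; [left|right; split=> // -[[]]].
  move=> [[[? ?] ?]|[[? ?] h]]; split=> //; [by left|right; split=> // ?].
  exact: h.
rewrite measureU//; last 3 first.
- by apply: measurableI => //; apply: measurableI.
- by apply: measurableD; apply: measurableI => //; apply: measurableI.
- by apply/seteqP; split=> // w /= [[[? ?] ?] [[? ?] h]]; exact: h.
rewrite measureD//; last 3 first.
- exact: measurableI.
- by apply: measurableI => //; apply: measurableI.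
- by rewrite -ge0_fin_numE// fin_num_measure//; apply: measurableI.
rewrite [C `&` WA `&` _](_ : _ = survA p `&` C `&` WA); last first.
  by apply/seteqP; split=> w /= => [[? ?] //|[[? ?] ?]].
transitivity ((q p * (\prod_(r in J) q r) * g (kill_B (S1, S2) p))%:E +
    ((\prod_(r in J) q r * g (kill_A (S1, S2) p))%:E -
     (q p * (\prod_(r in J) q r) * g (kill_A (S1, S2) p))%:E))%E.
  by congr (_ + (_ - _))%E; [exact: E1|exact: E3|exact: E2].
rewrite -EFinB -EFinD (gr (S1, S2) p al); congr EFin.
by ring.
Qed.

End ScatteringProbability.

(** * The recursion for the win region *)

Section WinningProbability.
Context (R : realType) (m n : nat) (a : 'I_m -> R) (b : 'I_n -> R).
Hypotheses (ha : forall i, 0 < a i) (hb : forall j, 0 < b j).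
Local Notation RM := (measurableTypeR R).
Local Notation U := (uniform_prob (@ltr01 R)).
Local Notation tup := ((m + n).-tuple RM).
Local Notation state := ({set 'I_m} * {set 'I_n})%type.

Definition prodA (S : {set 'I_m}) (t : tup) : R :=
  \prod_(i in S) (tnth t (lshift n i) `^ a i).
Definition prodB (S : {set 'I_n}) (t : tup) : R :=
  \prod_(j in S) (tnth t (rshift m j) `^ b j).
(** Coordinates of dead particles stay as dummy variables of total mass [1], so the dimension
    remains [m + n] throughout the recursion. *)
Definition win_ind (S : state) (t : tup) : \bar R :=
  ind R (prodA S.1 t < prodB S.2 t).

Lemma prodA_ge0 S t : 0 <= prodA S t.
Proof. by apply: prodr_ge0 => i _; exact: powR_ge0. Qed.

Lemma prodB_ge0 S t : 0 <= prodB S t.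
Proof. by apply: prodr_ge0 => i _; exact: powR_ge0. Qed.

Lemma powR_le1 (x r : R) : 0 < r -> 0 <= x <= 1 -> x `^ r <= 1.
Proof.
move=> r0 /andP[x0 x1]; have -> : 1 = 1 `^ r :> R by rewrite powR1.
by apply: ge0_ler_powR => //; rewrite ?nnegrE ?ltW.
Qed.

Lemma prodA_le1 S t : in_cube t -> prodA S t <= 1.
Proof.
by move=> ht; apply: prodr_ile1 => i _; rewrite powR_ge0 powR_le1.
Qed.

Lemma prodB_le1 S t : in_cube t -> prodB S t <= 1.
Proof.
by move=> ht; apply: prodr_ile1 => i _; rewrite powR_ge0 powR_le1.
Qed.

Lemma measurable_prod_powR k (I : finType) (s : seq I) (Q : pred I)
    (h : I -> 'I_k) (r : I -> R) :
  measurable_fun setT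
    (fun t : k.-tuple RM => \prod_(i <- s | Q i) (tnth t (h i) `^ r i)).
Proof.
elim: s => [|i s IH].
  by under eq_fun do rewrite big_nil; exact: measurable_cst.
under eq_fun do rewrite big_cons.
case: (Q i) => //; apply: measurable_funM => //.
apply: (@measurableT_comp _ _ _ _ _ _ (fun x : RM => x `^ r i)).
  exact: measurable_powR.
exact: measurable_tnth.
Qed.

Lemma measurable_win_ind S : measurable_fun setT (win_ind S).
Proof. by apply: measurable_ind; exact: measurable_prod_powR. Qed.

Lemma win_ind_ge0 S t : (0 <= win_ind S t)%E.
Proof. exact: ind_ge0. Qed.

Lemma measurable_resample (k : 'I_(m + n)) (f : tup -> \bar R) :
  (forall t, (0 <= f t)%E) -> measurable_fun setT f ->
  measurable_fun setT (fun t => \int[U]_x f (upd k x t))%E.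
Proof.
move=> f0 mf.
apply: (@measurable_fun_fubini_tonelli_G _ _ RM tup R U (fun z => f (upd k z.1 z.2))) => //.
exact: (measurableT_comp mf (@measurable_upd R _ k)).
Qed.

Lemma prodA_updA (S : {set 'I_m}) i x t : i \in S ->
  prodA S (upd (lshift n i) x t) = x `^ a i * prodA (S :\ i) t.
Proof.
move=> iS; rewrite /prodA (big_setD1 i)//= tnth_upd eqxx; congr *%R.
apply: eq_bigr => k; rewrite !inE => /andP[ki _].
by rewrite tnth_upd eq_lshift (negbTE ki).
Qed.

Lemma prodA_updB S j x t : prodA S (upd (rshift m j) x t) = prodA S t.
Proof. by apply: eq_bigr => k _; rewrite tnth_upd eq_lrshift. Qed.

Lemma prodB_updB (S : {set 'I_n}) j x t : j \in S ->
  prodB S (upd (rshift m j) x t) = x `^ b j * prodB (S :\ j) t.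
Proof.
move=> iS; rewrite /prodB (big_setD1 j)//= tnth_upd eqxx; congr *%R.
apply: eq_bigr => k; rewrite !inE => /andP[ki _].
by rewrite tnth_upd eq_rshift (negbTE ki).
Qed.

Lemma prodB_updA S i x t : prodB S (upd (lshift n i) x t) = prodB S t.
Proof. by apply: eq_bigr => k _; rewrite tnth_upd eq_rlshift. Qed.

(** Both coordinates of the colliding pair are resampled; with all others frozen, the claim becomes
    the two-dimensional identity [integral_ind_powR2]. *)
Lemma cube_int_win_rec S p : alive S p ->
  cube_int (win_ind S) =
  ((a p.1 / (a p.1 + b p.2))%:E * cube_int (win_ind (kill_B S p)) +
   (b p.2 / (a p.1 + b p.2))%:E * cube_int (win_ind (kill_A S p)))%E.
Proof.
case: S p => S1 S2 [i j] /andP[/= iS jS].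
have ab0 : 0 < a i + b j by rewrite addr_gt0.
(* The coordinate of B is resampled first, so that its integral ends up inside that of A, as in
   [integral_ind_powR2]. *)
rewrite -(@cube_int_resample R _ (rshift m j) (win_ind (S1, S2))); last 2 first.
- exact: win_ind_ge0.
- exact: measurable_win_ind.
rewrite -(@cube_int_resample R _ (lshift n i)); last 2 first.
- by move=> t; apply: integral_ge0 => y _; exact: win_ind_ge0.
- by apply: measurable_resample; [exact: win_ind_ge0|exact: measurable_win_ind].
(* On the right only the coordinate of the survivor still matters, so one resampling per term
   suffices. *)
rewrite -(@cube_int_resample R _ (lshift n i) (win_ind (kill_B _ _))); last 2 first.
- exact: win_ind_ge0.
- exact: measurable_win_ind.
rewrite -(@cube_int_resample R _ (rshift m j) (win_ind (kill_A _ _))); last 2 first.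
- exact: win_ind_ge0.
- exact: measurable_win_ind.
have mr k S : measurable_fun setT (fun t => \int[U]_x win_ind S (upd k x t))%E.
  by apply: measurable_resample; [exact: win_ind_ge0|exact: measurable_win_ind].
have r0 k S t : (0 <= \int[U]_x win_ind S (upd k x t))%E.
  by apply: integral_ge0 => y _; exact: win_ind_ge0.
rewrite -cube_intZl//; last by rewrite divr_ge0 ?ltW.
rewrite -cube_intZl//; last by rewrite divr_ge0 ?ltW.
rewrite -cube_intD; last 4 first.
- by move=> t; rewrite mule_ge0// lee_fin divr_ge0 ?ltW.
- exact: measurable_funeM.
- by move=> t; rewrite mule_ge0// lee_fin divr_ge0 ?ltW.
- exact: measurable_funeM.
congr cube_int; apply/funext => t.
(* The constants are [c = prodA (S1 :\ i) t] and [d = prodB (S2 :\ j) t]. *)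
rewrite /win_ind /kill_A /kill_B /=.
under eq_integral do under eq_integral do
  rewrite prodA_updB (prodA_updA _ _ iS) (prodB_updB _ _ jS) prodB_updA.
under [in RHS]eq_integral do rewrite prodB_updA (prodA_updA _ _ iS).
under [X in (_ + _ * X)%E]eq_integral do rewrite prodA_updB (prodB_updB _ _ jS).
by apply: integral_ind_powR2; rewrite ?prodA_ge0 ?prodB_ge0.
Qed.

(** * Measure of the winning set and extinct states *)

Lemma measurable_win_set S :
  measurable [set t : tup | prodA S.1 t < prodB S.2 t].
Proof.
rewrite -[X in measurable X]setTI.
by apply: (@measurable_fun_ltr _ tup R setT (prodA S.1) (prodB S.2) _ _ _ [set true]) => //;
  exact: measurable_prod_powR.
Qed.

Lemma lebesgue_cube_win S :
  lebesgue_tuple R (m + n) (@in_cube R _ `&`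
    [set t : tup | prodA S.1 t < prodB S.2 t]) = cube_int (win_ind S).
Proof.
rewrite lebesgue_tuple_cube; last exact: measurable_win_set.
by congr cube_int; apply/funext => t; rewrite indicE mem_setE.
Qed.

(** The set lies in the unit cube, of measure [1]. Finiteness lets the recursion be stated over the
    reals through [fine]. *)
Lemma cube_int_win_fin_num S : cube_int (win_ind S) \is a fin_num.
Proof.
rewrite -lebesgue_cube_win ge0_fin_numE//.
apply: (@le_lt_trans _ _ (lebesgue_tuple R (m + n) (@in_cube R _ `&` setT))).
  apply: le_measure; rewrite ?inE.
  - by apply: measurableI; [exact: measurable_in_cube|exact: measurable_win_set].
  - by apply: measurableI => //; exact: measurable_in_cube.
  - exact: setIS.
rewrite lebesgue_tuple_cube//.
under eq_fun do rewrite indicT.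
by rewrite cube_int_cst ltry.
Qed.

(** The strict inequality [prodA S1 t < 1] may fail on the boundary of the cube, so there is no
    pointwise proof. Integrating out one alive coordinate gives [1], since the remaining product is
    at most [1]. *)
Lemma cube_int_winA S1 : S1 != finset.set0 ->
  cube_int (win_ind (S1, finset.set0)) = 1%E.
Proof.
case/set0Pn => i iS.
rewrite -(@cube_int_resample R _ (lshift n i) (win_ind _)); last 2 first.
- exact: win_ind_ge0.
- exact: measurable_win_ind.
rewrite -[RHS](@cube_int_cst R (m + n) 1).
apply: eq_cube_int => //.
- by move=> t; apply: integral_ge0 => y _; exact: win_ind_ge0.
- by apply: measurable_resample; [exact: win_ind_ge0|exact: measurable_win_ind].
move=> t ht; rewrite /win_ind /=.
have B1 t' : prodB finset.set0 t' = 1 by rewrite /prodB big_set0.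
under eq_integral do rewrite (prodA_updA _ _ iS) B1.
have := prodA_ge0 (S1 :\ i) t; rewrite le_eqVlt => /predU1P[<-|c0].
  under eq_integral do rewrite mulr0 ltr01.
  rewrite integral_cst// [X in (_ * X)%E](_ : _ = 1%E) ?mule1//; exact: probability_setT.
rewrite integral_ind_powRl//; congr EFin; apply/min_idPl.
have {1}-> : 1 = 1 `^ (a i)^-1 :> R by rewrite powR1.
apply: ge0_ler_powR.
- by rewrite invr_ge0 ltW.
- by rewrite nnegrE.
- by rewrite nnegrE divr_ge0// ltW.
- by rewrite div1r invf_ge1// prodA_le1.
Qed.

(** The empty product is [1] and products of powers on the cube never exceed it, so the strict
    inequality fails at every point. *)
Lemma cube_int_winB S2 : cube_int (win_ind (finset.set0, S2)) = 0%E.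
Proof.
rewrite -[RHS](@cube_int_cst R (m + n) 0).
apply: eq_cube_int => //.
- exact: win_ind_ge0.
- exact: measurable_win_ind.
move=> t ht; rewrite /win_ind /= [prodA _ _]big_set0.
by rewrite ltNge prodB_le1.
Qed.

Lemma lebesgue_win_region :
  lebesgue_tuple R (m + n) (win_region a b) =
  cube_int (win_ind (finset.setT, finset.setT)).
Proof.
rewrite -lebesgue_cube_win; congr (lebesgue_tuple R (m + n) _).
rewrite /prodA /prodB; apply/seteqP.
by split=> t /= [h1 h2]; split=> //; move: h2;
  rewrite ![\prod_(i in finset.setT) _](eq_bigl xpredT)// => i; rewrite inE.
Qed.

End WinningProbability.

Theorem mainTheorem1 (R : realType) (m n : nat) (hm : (1 <= m)%N) (hn : (1 <= n)%N)
  (a : 'I_m -> R) (b : 'I_n -> R)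
  (ha : forall i, 0 < a i) (hb : forall j, 0 < b j)
  (u : 'I_m -> R) (v : 'I_n -> R) (huv : forall i j, u i < v j)
  (s : seq ('I_m * 'I_n)) (hs : processing_order a u b v s)
  (d : measure_display) (T : measurableType d) (P : probability T R)
  (survA : 'I_m * 'I_n -> set T)
  (survA_meas : forall p, measurable (survA p))
  (survA_prob : forall p, P (survA p) = (a p.1 / (a p.1 + b p.2))%:E)
  (survA_indep : mutually_independent P survA) :
  P [set w | A_wins (fun p => w \in survA p) s] =
  lebesgue_tuple R (m + n) (win_region a b).
Proof.
pose g (S : {set 'I_m} * {set 'I_n}) : R := fine (cube_int (win_ind a b S)).
pose q (p : 'I_m * 'I_n) := a p.1 / (a p.1 + b p.2).
have gE S : (g S)%:E = cube_int (win_ind a b S).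
  by rewrite /g fineK// cube_int_win_fin_num.
have ps : perm_eq s (enum {: 'I_m * 'I_n}) by case/andP: hs.
(* The process starts with everyone alive and no collision decided, hence the empty [J]. *)
have := @wins_from_prob R m n d T P survA q survA_meas survA_prob survA_indep g _ _ _
  s (finset.setT, finset.setT) finset.set0.
rewrite big_set0 mul1r gE -lebesgue_win_region => <-.
- congr (P _); apply/seteqP; split=> w /=; first by move=> h; split=> // p; rewrite /= inE.
  by case.
- by move=> S1 S10; rewrite /g cube_int_winA.
- by move=> S2; rewrite /g cube_int_winB.
- move=> S p al; apply: EFin_inj; rewrite gE (cube_int_win_rec ha hb al).
  rewrite EFinD !EFinM !gE; congr (_ + _ * _)%E; congr EFin.
  by rewrite /q; field; rewrite gt_eqF// addr_gt0.
- by rewrite (perm_uniq ps) enum_uniq.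
- by move=> p; rewrite inE.
- by move=> p _; rewrite (perm_mem ps) mem_enum.
(* Since [m] is positive, a type A particle exists and the initial state is not doubly extinct. *)
- by apply/orP; left; apply/set0Pn; exists (Ordinal hm).
Qed.
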